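(* Consider the one-dimensional Maxwell--Lorentz finite difference scheme of Kashiwa et al. (coupling the variables $B$, $E$, $P$, $J$) in the anharmonic case $\nu>0$, with parameters $\epsilon_0,\mu_0,\epsilon_\infty,\omega_1,\delta t,\delta x>0$ and $\epsilon_s\ge\epsilon_\infty$, and let $c_\infty=1/\sqrt{\epsilon_0\epsilon_\infty\mu_0}$. The scheme is stable under the condition $$\delta t<\frac{\delta x}{c_\infty}.$$
   Context: The scheme is, for $j,n$ integers, $$\tfrac1{\delta t}(B_{j+1/2}^{n+1/2}-B_{j+1/2}^{n-1/2})=-\tfrac1{\delta x}(E_{j+1}^n-E_j^n),$$ $$\tfrac{\epsilon_0\epsilon_\infty}{\delta t}(E_j^{n+1}-E_j^n)=-\tfrac1{\mu_0\delta x}(B_{j+1/2}^{n+1/2}-B_{j-1/2}^{n+1/2})-\tfrac1{\delta t}(P_j^{n+1}-P_j^n),\qquad \tfrac1{\delta t}(P_j^{n+1}-P_j^n)=\tfrac12(J_j^{n+1}+J_j^n),$$ $$\tfrac1{\delta t}(J_j^{n+1}-J_j^n)=-\tfrac\nu2(J_j^{n+1}+J_j^n)+\tfrac{\omega_1^2(\epsilon_s-\epsilon_\infty)\epsilon_0}2(E_j^{n+1}+E_j^n)-\tfrac{\omega_1^2}2(P_j^{n+1}+P_j^n).$$ Here $\nu$ is the damping coefficient and $\omega_1$ the resonant frequency. Put $\lambda=c_\infty\delta t/\delta x$, $\delta=\nu\delta t/2$, $\omega=\omega_1^2\delta t^2/2$, $\epsilon_s'=\epsilon_s/\epsilon_\infty$,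 $\alpha=\epsilon_s'-1$, $\Delta=1+\delta+\frac12\omega\epsilon_s'$ and, for $\xi\in\mathbb R$, $\sigma=\lambda(e^{i\xi}-1)$, $q=|\sigma|^2=4\lambda^2\sin^2(\xi/2)$; a star denotes complex conjugation. For plane waves $U_j^n=U^n e^{i\xi j}$ in the variable $U_j^n=(c_\infty B_{j+1/2}^{n-1/2},E_j^n,P_j^n/(\epsilon_0\epsilon_\infty),\delta t\,J_j^n/(\epsilon_0\epsilon_\infty))^t$ the scheme reads $U^{n+1}=G(\xi)U^n$ with amplification matrix $$G(\xi)=\begin{pmatrix}1&-\sigma&0&0\\ \frac{\sigma^*(\Delta-\frac12\omega\alpha)}{\Delta}&\frac{(1-q)\Delta-(2-q)\frac12\omega\alpha}{\Delta}&\frac\omega{\Delta}&-\frac1{\Delta}\\ \frac{\sigma^*\frac12\omega\alpha}{\Delta}&\frac{(2-q)\frac12\omega\alpha}{\Delta}&\frac{\Delta-\omega}{\Delta}&\frac1{\Delta}\\ \frac{\sigma^*\omega\alpha}{\Delta}&\frac{(2-q)\omega\alpha}{\Delta}&-\frac{2\omega}{\Delta}&\frac{2-\Delta}{\Delta}\end{pmatrix}.$$ Stability (in the sense of von Neumann) means: for every $\xi\in\mathbb R$, the sequence of powers $(G(\xi)^n)_{n\ge0}$ is bounded. *)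

(* Defs.v *)
From HB Require Import structures.
From mathcomp Require Import all_boot all_order all_algebra.
From mathcomp Require Import reals trigo.
From mathcomp Require Import complex.
From mathcomp Require Import ring.

Set Implicit Arguments.
Unset Strict Implicit.
Unset Printing Implicit Defensive.

Import Order.TTheory GRing.Theory Num.Theory.

Local Open Scope ring_scope.
Local Open Scope complex_scope.

(* Physical and discretization parameters, as bare real numbers: no sign
   condition is built in. *)
Record params (R : realType) := Params {
  eps0 : R; mu0 : R; epsinf : R; epss : R;
  nu : R; omega1 : R;
  dt : R; dx : R }.

Section MaxwellLorentz.
Context {R : realType}.
Implicit Types (p : params R) (xi : R).

Definition cinf p : R := 1 / Num.sqrt (eps0 p * epsinf p * mu0 p).

(* Staggered unknowns: [E j n], [P j n], [J j n] are the values at the grid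
   point (j, n), while [B j n] is the value of B at (j + 1/2, n - 1/2). *)
Definition scheme p (B E P J : int -> int -> R[i]) : Prop :=
  forall j n : int,
  [/\ (1 / dt p)%:C * (B j (n + 1) - B j n)
        = - ((1 / dx p)%:C * (E (j + 1) n - E j n)),
      (eps0 p * epsinf p / dt p)%:C * (E j (n + 1) - E j n)
        = - ((1 / (mu0 p * dx p))%:C * (B j (n + 1) - B (j - 1) (n + 1)))
          - (1 / dt p)%:C * (P j (n + 1) - P j n),
      (1 / dt p)%:C * (P j (n + 1) - P j n)
        = (1 / 2)%:C * (J j (n + 1) + J j n) &
      (1 / dt p)%:C * (J j (n + 1) - J j n)
        = - ((nu p / 2)%:C * (J j (n + 1) + J j n))
          + (omega1 p ^+ 2 * (epss p - epsinf p) * eps0 p / 2)%:C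
              * (E j (n + 1) + E j n)
          - (omega1 p ^+ 2 / 2)%:C * (P j (n + 1) + P j n)].

Definition lambda p : R := cinf p * dt p / dx p.
Definition delta p : R := nu p * dt p / 2.
Definition omega p : R := omega1 p ^+ 2 * dt p ^+ 2 / 2.
Definition epss' p : R := epss p / epsinf p.
Definition alpha p : R := epss' p - 1.
Definition Delta p : R := 1 + delta p + 1 / 2 * omega p * epss' p.

Definition expi (x : R) : R[i] := cos x +i* sin x.

Definition sigma p xi : R[i] := (lambda p)%:C * (expi xi - 1).
Definition q p xi : R[i] := `|sigma p xi| ^+ 2.

Definition mx4 (s : seq (seq R[i])) : 'M[R[i]]_4 :=
  \matrix_(i, j) nth 0 (nth [::] s i) j.

Definition G p xi : 'M[R[i]]_4 :=
  let s := sigma p xi in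
  let s' := s^*%R in
  let q := q p xi in
  let D := (Delta p)%:C in
  let w := (omega p)%:C in
  let hwa := (1 / 2 * omega p * alpha p)%:C in
  let wa := (omega p * alpha p)%:C in
  mx4
  [:: [:: 1; - s; 0; 0];
      [:: s' * (D - hwa) / D; ((1 - q) * D - (2 - q) * hwa) / D;
          w / D; - (1 / D)];
      [:: s' * hwa / D; (2 - q) * hwa / D; (D - w) / D; 1 / D];
      [:: s' * wa / D; (2 - q) * wa / D; - (2 * w / D); (2 - D) / D]].

(* Rescaled unknowns U_j^n. *)
Definition state p (B E P J : int -> int -> R[i]) (j n : int) : 'cV[R[i]]_4 :=
  \col_i nth 0
    [:: (cinf p)%:C * B j n;
        E j n;
        P j n / (eps0 p * epsinf p)%:C;
        (dt p)%:C * J j n / (eps0 p * epsinf p)%:C] i.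

(* All norms on matrices of size 4 are equivalent; this uses the largest
   modulus of an entry. *)
Definition bounded_powers (A : 'M[R[i]]_4) : Prop :=
  exists M : R, forall (n : nat) (i j : 'I_4), `|(A ^+ n) i j| <= M%:C.

Definition stable p : Prop := forall xi : R, bounded_powers (G p xi).

(* [qE] and [scheme_plane_wave] justify the formulas for [q] and [G]; the
   latter says that G is the amplification matrix of the scheme. *)

Lemma qE p xi : q p xi = (4 * lambda p ^+ 2 * sin (xi / 2) ^+ 2)%:C.
Proof.
rewrite /q /sigma /expi sqr_normc; apply/eqP; rewrite eq_complex /=.
have e : xi = xi / 2 + xi / 2 by field.
have h := cos2Dsin2 (xi / 2).
set c := cos (xi / 2) in h *; set s := sin (xi / 2) in h *.
have hc : c ^+ 2 = 1 - s ^+ 2 by rewrite -h; ring.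
have -> : cos xi = 1 - 2 * s ^+ 2.
  by rewrite e cosD -/c -/s -!expr2 hc; ring.
have -> : sin xi = 2 * s * c by rewrite e sinD -/c -/s; ring.
apply/andP; split; apply/eqP; last by ring.
transitivity (lambda p ^+ 2 * (4 * s ^+ 4 + 4 * s ^+ 2 * c ^+ 2)); first by ring.
by rewrite hc; ring.
Qed.

Lemma expiD (x y : R) : expi (x + y) = expi x * expi y.
Proof.
rewrite /expi cosD sinD; apply/eqP; rewrite eq_complex /=.
by apply/andP; split; apply/eqP; ring.
Qed.

Lemma expiN (x : R) : expi x * expi (- x) = 1.
Proof. by rewrite -expiD subrr /expi cos0 sin0. Qed.

Lemma sigma_conj p xi : (sigma p xi)^*%R = (lambda p)%:C * (expi (- xi) - 1).
Proof.
rewrite /sigma /expi cosN sinN; apply/eqP; rewrite eq_complex /=.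
by apply/andP; split; apply/eqP; ring.
Qed.

Lemma eq_iff_scaled (F : fieldType) (k a b a' b' : F) :
  k != 0 -> a - b = k * (a' - b') -> a = b <-> a' = b'.
Proof.
move=> k0 h; split=> e; apply/subr0_eq.
  by apply: (mulfI k0); rewrite -h e subrr mulr0.
by rewrite h e subrr mulr0.
Qed.

Lemma normalized_iff (F : fieldType) (s sb d w a : F)
    (b x y z b' x' y' z' : F) :
  let D := 1 + d + 1 / 2 * w * (a + 1) in
  let q := s * sb in
  let h := 1 / 2 * w * a in
  2 != 0 :> F -> D != 0 ->
  [/\ b' = b - s * x, x' - x = sb * b' - (y' - y),
      y' - y = 1 / 2 * (z' + z) &
      z' - z = - (d * (z' + z)) + w * a * (x' + x) - w * (y' + y)] <->
  [/\ b' = 1 * b + - s * x + 0 * y + 0 * z,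
      x' = sb * (D - h) / D * b + ((1 - q) * D - (2 - q) * h) / D * x
           + w / D * y + - (1 / D) * z,
      y' = sb * h / D * b + (2 - q) * h / D * x + (D - w) / D * y + 1 / D * z &
      z' = sb * (w * a) / D * b + (2 - q) * (w * a) / D * x
           + - (2 * w / D) * y + (2 - D) / D * z].
Proof.
move=> D q h n2 D0.
have ed : d = D - 1 - 1 / 2 * w * (a + 1) by rewrite /D; ring.
move: D ed D0 => D -> D0 {d}; rewrite /q /h {q h}.
split=> [[eb ex ey ez]|[eb ex ey ez]].
  have ey1 : y' = y + 1 / 2 * (z' + z) by rewrite -ey; ring.
  have ex1 : x' = x + sb * (b - s * x) - 1 / 2 * (z' + z).
    by rewrite -ey -eb; apply: (addIr (- x)); rewrite ex; ring.
  have ez1 : z' = sb * (w * a) / D * b + (2 - s * sb) * (w * a) / D * x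
           + - (2 * w / D) * y + (2 - D) / D * z.
    apply: (mulfI D0); apply: subr0_eq.
    transitivity (z' - z - (- ((D - 1 - 1 / 2 * w * (a + 1)) * (z' + z))
      + w * a * (x' + x) - w * (y' + y))); last by rewrite ez subrr.
    by rewrite ex1 ey1; field; rewrite ?D0 ?n2.
  split=> //; first by rewrite eb; ring.
    by rewrite ex1 ez1; field; rewrite ?D0 ?n2.
  by rewrite ey1 ez1; field; rewrite ?D0 ?n2.
have eb1 : b' = b - s * x by rewrite eb; ring.
by split; rewrite ?eb1 // ?ex ?ey ?ez; field; rewrite ?D0 ?n2.
Qed.

Lemma mx4_mulE (s : seq (seq R[i])) (u v : 'cV[R[i]]_4) :
  let o k (h : (k < 4)%N) : 'I_4 := Ordinal h in
  let i0 := o 0%N isT in let i1 := o 1%N isT in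
  let i2 := o 2%N isT in let i3 := o 3%N isT in
  let r k := nth 0 (nth [::] s k) 0 * u i0 0 + nth 0 (nth [::] s k) 1 * u i1 0
    + nth 0 (nth [::] s k) 2 * u i2 0 + nth 0 (nth [::] s k) 3 * u i3 0 in
  v = mx4 s *m u <->
  [/\ v i0 0 = r 0%N, v i1 0 = r 1%N, v i2 0 = r 2%N & v i3 0 = r 3%N].
Proof.
move=> o i0 i1 i2 i3 r.
have mE i : (mx4 s *m u) i 0 = r i.
  rewrite mxE !big_ord_recl big_ord0 addr0 !mxE /= !addrA /r.
  by do ![congr (_ + _)]; congr (_ * u _ _); apply: val_inj.
split=> [->|[e0 e1 e2 e3]]; first by rewrite !mE.
apply/matrixP=> i j; rewrite ord1 mE.
by case: i => [[|[|[|[|//]]]] h] /=; rewrite (bool_irrelevance h isT).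
Qed.

Lemma scheme_plane_wave p xi (B E P J : int -> int -> R[i])
    (U : int -> 'cV[R[i]]_4) :
  0 < eps0 p -> 0 < mu0 p -> 0 < epsinf p -> 0 < omega1 p ->
  0 < dt p -> 0 < dx p -> epsinf p <= epss p -> 0 <= nu p ->
  (forall j n, state p B E P J j n = expi (xi * j%:~R) *: U n) ->
  scheme p B E P J <-> forall n, U (n + 1) = G p xi *m U n.
Proof.
move=> e0p m0p eip w1p tp xp le_ei nup hU.
have c0 : 0 < cinf p by rewrite divr_gt0 // sqrtr_gt0 !mulr_gt0.
have k0 : 0 < eps0 p * epsinf p * mu0 p by rewrite !mulr_gt0.
have c2 : (cinf p) ^+ 2 * (eps0 p * epsinf p * mu0 p) = 1.
  by rewrite /cinf expr_div_n sqr_sqrtr ?ltW // expr1n divfK ?gt_eqF.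
have D0 : 0 < Delta p.
  have es0 : 0 <= epss p := le_trans (ltW eip) le_ei.
  rewrite /Delta /delta /omega /epss' -addrA ltr_pwDl // addr_ge0 //.
    by rewrite divr_ge0 // mulr_ge0 // ltW.
  by rewrite !mulr_ge0 ?invr_ge0 ?exprn_ge0 // ltW.
have Cn0 (x : R) : 0 < x -> x%:C != 0.
  by move=> x0; rewrite fmorph_eq0 gt_eqF.
pose o k (h : (k < 4)%N) : 'I_4 := Ordinal h.
pose e (j : int) := expi (xi * j%:~R).
have hB j n : B j n = e j * U n (o 0%N isT) 0 / (cinf p)%:C.
  have := congr1 (fun M : 'cV[R[i]]_4 => M (o 0%N isT) 0) (hU j n).
  by rewrite !mxE /= -/(e j) => <-; field; apply: Cn0.
have hE j n : E j n = e j * U n (o 1%N isT) 0.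
  have := congr1 (fun M : 'cV[R[i]]_4 => M (o 1%N isT) 0) (hU j n).
  by rewrite !mxE.
have hP j n : P j n = e j * U n (o 2%N isT) 0 * (eps0 p * epsinf p)%:C.
  have := congr1 (fun M : 'cV[R[i]]_4 => M (o 2%N isT) 0) (hU j n).
  by rewrite !mxE /= -/(e j) => <-; rewrite divfK // Cn0 // mulr_gt0.
have hJ j n : J j n = e j * U n (o 3%N isT) 0 * (eps0 p * epsinf p)%:C / (dt p)%:C.
  have := congr1 (fun M : 'cV[R[i]]_4 => M (o 3%N isT) 0) (hU j n).
  rewrite !mxE /= -/(e j) => <-; rewrite divfK ?Cn0 ?mulr_gt0 //.
  by rewrite mulrAC divff ?mul1r ?Cn0.
have eS j : e (j + 1) = e j * expi xi.
  by rewrite /e intrD mulrDr mulr1 expiD.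
have eP j : e (j - 1) = e j * expi (- xi).
  by rewrite /e intrD mulrDr mulrN1 expiD.
have e0 j : e j != 0.
  by apply/eqP=> ej; have /eqP := expiN (xi * j%:~R); rewrite -/(e j) ej mul0r
    eq_sym oner_eq0.
have n2 : 2 != 0 :> R[i] by rewrite pnatr_eq0.
have cR : mu0 p = (cinf p ^+ 2 * eps0 p * epsinf p)^-1.
  have : cinf p ^+ 2 * eps0 p * epsinf p != 0.
    by apply: lt0r_neq0; apply: mulr_gt0 => //; apply: mulr_gt0 => //; apply: exprn_gt0.
  move=> n0; apply: (mulIf n0); rewrite mulVf //.
  by rewrite -[RHS]c2; ring.
have cCE : (mu0 p)%:C = ((cinf p)%:C ^+ 2 * (eps0 p)%:C * (epsinf p)%:C)^-1.
  by rewrite {1}cR fmorphV !rmorphM /=.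
have key j n :
  [/\ (1 / dt p)%:C * (B j (n + 1) - B j n)
        = - ((1 / dx p)%:C * (E (j + 1) n - E j n)),
      (eps0 p * epsinf p / dt p)%:C * (E j (n + 1) - E j n)
        = - ((1 / (mu0 p * dx p))%:C * (B j (n + 1) - B (j - 1) (n + 1)))
          - (1 / dt p)%:C * (P j (n + 1) - P j n),
      (1 / dt p)%:C * (P j (n + 1) - P j n)
        = (1 / 2)%:C * (J j (n + 1) + J j n) &
      (1 / dt p)%:C * (J j (n + 1) - J j n)
        = - ((nu p / 2)%:C * (J j (n + 1) + J j n))
          + (omega1 p ^+ 2 * (epss p - epsinf p) * eps0 p / 2)%:C
              * (E j (n + 1) + E j n)
          - (omega1 p ^+ 2 / 2)%:C * (P j (n + 1) + P j n)]
  <-> U (n + 1) = G p xi *m U n.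
  rewrite /G mx4_mulE /=.
  set b := U n (o 0%N isT) 0; set x := U n (o 1%N isT) 0.
  set y := U n (o 2%N isT) 0; set z := U n (o 3%N isT) 0.
  set b' := U _ (o 0%N isT) 0; set x' := U _ (o 1%N isT) 0.
  set y' := U _ (o 2%N isT) 0; set z' := U _ (o 3%N isT) 0.
  have := @normalized_iff _ (sigma p xi) (sigma p xi)^*%R (delta p)%:C (omega p)%:C
    (alpha p)%:C b x y z b' x' y' z'.
  have -> : 1 + (delta p)%:C + 1 / 2 * (omega p)%:C * ((alpha p)%:C + 1)
            = (Delta p)%:C.
    by rewrite /Delta /alpha !(rmorphD, rmorphB, rmorphM, fmorphV, rmorph1, rmorph_nat); ring.
  have -> : 1 / 2 * (omega p)%:C * (alpha p)%:C = (1 / 2 * omega p * alpha p)%:C.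
    by rewrite !(rmorphM, fmorphV, rmorph1, rmorph_nat).
  rewrite /= -normCK -/(q p xi) -(rmorphM _ (omega p)).
  move=> /(_ n2 (Cn0 _ D0)) <-.
  have iff4 (A1 A2 A3 A4 B1 B2 B3 B4 : Prop) : A1 <-> B1 -> A2 <-> B2 -> A3 <-> B3 ->
    A4 <-> B4 -> [/\ A1, A2, A3 & A4] <-> [/\ B1, B2, B3 & B4].
    by move=> [? ?] [? ?] [? ?] [? ?]; split=> -[? ? ? ?]; split; auto.
  rewrite sigma_conj.
  rewrite !hB !hE !hP !hJ !eS !eP /sigma /lambda /delta /omega /alpha /epss'.
  have [c hc] : exists c, c = cinf p by exists (cinf p).
  rewrite -hc in c0 cCE *.
  have := e0 j; move: (e j) => ej ej0; rewrite -/b -/x -/y -/z -/b' -/x' -/y' -/z'.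
  have := (Cn0 _ e0p, Cn0 _ eip, Cn0 _ tp, Cn0 _ xp, Cn0 _ c0).
  have cM (u v : R) : (u * v)%:C = u%:C * v%:C by rewrite rmorphM.
  have cB (u v : R) : (u - v)%:C = u%:C - v%:C by rewrite rmorphB.
  have cV (u : R) : (u^-1)%:C = u%:C^-1 by rewrite fmorphV.
  have cX (u : R) : (u ^+ 2)%:C = u%:C ^+ 2 by rewrite rmorphXn.
  have c2E : (2 : R)%:C = 2 by rewrite rmorph_nat.
  rewrite !(cM, cB, cV, cX) !c2E !cCE.
  move=> [[[[E0 EI] T0] X0] C0].
  apply: iff4.
  - apply: (@eq_iff_scaled _ (ej / ((dt p)%:C * c%:C))).
      by repeat first [assumption | apply: mulf_neq0 | apply: invr_neq0
                      | apply: expf_neq0].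
    by field; rewrite ?T0 ?X0 ?C0.
  - apply: (@eq_iff_scaled _ (ej * (eps0 p)%:C * (epsinf p)%:C / (dt p)%:C)).
      by repeat first [assumption | apply: mulf_neq0 | apply: invr_neq0
                      | apply: expf_neq0].
    by field; rewrite ?T0 ?X0 ?C0 ?E0 ?EI.
  - apply: (@eq_iff_scaled _ (ej * (eps0 p)%:C * (epsinf p)%:C / (dt p)%:C)).
      by repeat first [assumption | apply: mulf_neq0 | apply: invr_neq0
                      | apply: expf_neq0].
    by field; rewrite ?T0 ?X0 ?C0 ?E0 ?EI.
  - apply: (@eq_iff_scaled _ (ej * (eps0 p)%:C * (epsinf p)%:C / (dt p)%:C ^+ 2)).
      by repeat first [assumption | apply: mulf_neq0 | apply: invr_neq0
                      | apply: expf_neq0].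
    by field; rewrite ?T0 ?X0 ?C0 ?E0 ?EI.
split=> [h n|h j n]; first by apply/(key 0 n).
by apply/key.
Qed.

End MaxwellLorentz.

(* Main.v *)
Require Import Defs.
From mathcomp Require Import all_boot all_order all_algebra.
From mathcomp Require Import reals.
From mathcomp Require Import trigo complex ring.

Import Order.TTheory GRing.Theory Num.Theory.
Local Open Scope ring_scope.

(** Write (b, x, y, z) for the rescaled (B, E, P, J) of a plane wave. The leapfrog
    energy F = |x|^2 + |b|^2 - Re(sigma x b^* ) of the Yee scheme is positive definite
    exactly because q = |sigma|^2 < 4, and the exchange term between F and the
    oscillator energy V = |z|^2 + 2 omega |y|^2 cancels in 2 omega alpha F + V, which
    loses delta |z' + z|^2 per step. This settles alpha > 0. When alpha = 0 the
    oscillator is autonomous and drives the wave; damping rules out resonance, so a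
    particular driven solution depending linearly on the state exists, and F of the
    wave minus that solution is conserved. *)

(** * Energy balance and coercivity for a single Fourier mode *)

Section Energies.
Context {C : numClosedFieldType}.
Implicit Types s d w a b x y z f g q u m B : C.

Definition yee_energy s b x : C :=
  x * x^* + b * b^* - (s * x * b^* + s^* * x^* * b) / 2.

Definition oscillator_energy w y z : C := z * z^* + 2 * w * (y * y^*).

(** The curl terms of the two equations telescope, leaving only the work of the source [f] against
    [x' + x]. *)
Lemma yee_energy_step s b x f b' x' :
  b' = b - s * x -> x' - x = s^* * b' - f ->
  yee_energy s b' x' = yee_energy s b x
    - (f * (x' + x)^* + f^* * (x' + x)) / 2.
Proof.
move=> eb ex.
have ex' : x' = x + s^* * b' - f by rewrite -[_ + _ - f]addrA -ex; ring.
rewrite /yee_energy ex' eb !(rmorphB, rmorphD, rmorphM) /= !conjCK.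
by field.
Qed.

(** Pair the equation for [z] with [z' + z], which is 2(y' - y): the restoring force becomes an
    increment of 2w|y|^2, whence the weight in [oscillator_energy]. Damping and the work of [g]
    remain. *)
Lemma oscillator_energy_step d w y z g y' z' :
  d^* = d -> w^* = w ->
  y' - y = 1 / 2 * (z' + z) ->
  z' - z = - (d * (z' + z)) + g - w * (y' + y) ->
  oscillator_energy w y' z' = oscillator_energy w y z
    - d * ((z' + z) * (z' + z)^*) + (g * (z' + z)^* + g^* * (z' + z)) / 2.
Proof.
move=> dR wR ey ez.
have -> : g = z' - z + d * (z' + z) + w * (y' + y) by rewrite ez; ring.
have -> : y' = y + 1 / 2 * (z' + z) by rewrite -ey; ring.
rewrite /oscillator_energy !(rmorphB, rmorphD, rmorphM, fmorphV, rmorph1) /=.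
by rewrite ?conjC_nat dR wR; field.
Qed.

(** Complete the square in [b], respectively in [x]; the leftover coefficient is positive exactly
    when |s|^2 < 4. *)
Lemma yee_energy_lower_bound s b x :
  (1 - s * s^* / 4) * `|x| ^+ 2 <= yee_energy s b x /\
  (1 - s * s^* / 4) * `|b| ^+ 2 <= yee_energy s b x.
Proof.
rewrite !normCK; split; rewrite -subr_ge0.
  suff -> : yee_energy s b x - (1 - s * s^* / 4) * (x * x^*)
            = (b - s * x / 2) * (b - s * x / 2)^* by apply: mul_conjC_ge0.
  rewrite /yee_energy !(rmorphB, rmorphM, fmorphV) /= conjC_nat.
  by field.
suff -> : yee_energy s b x - (1 - s * s^* / 4) * (b * b^*)
            = (x - s^* * b / 2) * (x - s^* * b / 2)^* by apply: mul_conjC_ge0.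
rewrite /yee_energy !(rmorphB, rmorphM, fmorphV) /= conjC_nat conjCK.
by field.
Qed.

(** The crude inequality t <= 1 + t^2 gives a bound without square roots. *)
Lemma norm_le_of_sqr_bound m B x :
  0 < m -> m * `|x| ^+ 2 <= B -> `|x| <= 1 + B / m.
Proof.
move=> m0 h; apply: (@le_trans _ _ (1 + `|x| ^+ 2)).
  rewrite -subr_ge0.
  have -> : 1 + `|x| ^+ 2 - `|x| = (`|x| - 1 / 2) ^+ 2 + 3 / 4 by field.
  rewrite addr_ge0 ?divr_ge0 // real_exprn_even_ge0 //.
  by rewrite realB // ger0_real ?divr_ge0.
by rewrite lerD2l ler_pdivlMr // mulrC.
Qed.

Lemma yee_energy_ge0 s b x : s * s^* < 4 -> 0 <= yee_energy s b x.
Proof.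
move=> q4; have [h _] := yee_energy_lower_bound s b x.
apply: le_trans h; rewrite mulr_ge0 ?exprn_ge0 //.
by rewrite subr_ge0 ler_pdivrMr // mul1r ltW.
Qed.

Lemma yee_energy_coercive s B : s * s^* < 4 ->
  exists M, forall b x, yee_energy s b x <= B -> `|b| <= M /\ `|x| <= M.
Proof.
move=> q4; exists (1 + B / (1 - s * s^* / 4)) => b x h.
have m0 : 0 < 1 - s * s^* / 4 by rewrite subr_gt0 ltr_pdivrMr // mul1r.
have [hx hb] := yee_energy_lower_bound s b x.
by split; apply: norm_le_of_sqr_bound => //; apply: le_trans h.
Qed.

Lemma oscillator_energy_ge0 w y z : 0 < w -> 0 <= oscillator_energy w y z.
Proof.
move=> w0; rewrite /oscillator_energy -!normCK addr_ge0 ?exprn_ge0 //.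
by rewrite !mulr_ge0 ?exprn_ge0 // ltW.
Qed.

Lemma oscillator_energy_coercive w B : 0 < w ->
  exists M, forall y z, oscillator_energy w y z <= B -> `|y| <= M /\ `|z| <= M.
Proof.
move=> w0; have w20 : 0 < 2 * w by rewrite mulr_gt0.
exists (1 + `|B| / 1 + `|B| / (2 * w)) => y z h.
have B0 : 0 <= B by apply: le_trans h; apply: oscillator_energy_ge0.
have Bw0 : 0 <= B / (2 * w) by rewrite divr_ge0 // ltW.
have B10 : 0 <= B / 1 by rewrite divr_ge0.
rewrite (ger0_norm B0); move: h; rewrite /oscillator_energy -!normCK => h.
have hz : `|z| <= 1 + B / 1.
  apply: norm_le_of_sqr_bound => //; apply: le_trans h.
  by rewrite mul1r lerDl mulr_ge0 ?exprn_ge0 // ltW.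
have hy : `|y| <= 1 + B / (2 * w).
  apply: norm_le_of_sqr_bound => //; apply: le_trans h.
  by rewrite lerDr exprn_ge0.
split; first by apply: (le_trans hy); rewrite addrAC lerDl.
by apply: (le_trans hz); rewrite lerDl.
Qed.

(** * The free oscillator and its non-resonance with the wave *)

Lemma oscillator_recurrence d w y z y1 z1 y2 z2 :
  y1 - y = 1 / 2 * (z1 + z) -> z1 - z = - (d * (z1 + z)) - w * (y1 + y) ->
  y2 - y1 = 1 / 2 * (z2 + z1) -> z2 - z1 = - (d * (z2 + z1)) - w * (y2 + y1) ->
  (1 + d + w / 2) * y2 = (2 - w) * y1 - (1 - d + w / 2) * y.
Proof.
move=> e1 f1 e2 f2; apply: subr0_eq.
have {}e1 : y1 - y - 1 / 2 * (z1 + z) = 0 by rewrite e1 subrr.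
have {}e2 : y2 - y1 - 1 / 2 * (z2 + z1) = 0 by rewrite e2 subrr.
have {}f1 : z1 - z - (- (d * (z1 + z)) - w * (y1 + y)) = 0 by rewrite f1 subrr.
have {}f2 : z2 - z1 - (- (d * (z2 + z1)) - w * (y2 + y1)) = 0 by rewrite f2 subrr.
(* The weights 1/2, 1 + d and -(1 - d) are those for which [z], [z1] and [z2] all cancel. *)
transitivity (1 / 2 * ((z1 - z - (- (d * (z1 + z)) - w * (y1 + y)))
  + (z2 - z1 - (- (d * (z2 + z1)) - w * (y2 + y1))))
  + (1 + d) * (y2 - y1 - 1 / 2 * (z2 + z1))
  - (1 - d) * (y1 - y - 1 / 2 * (z1 + z))); last by rewrite e1 e2 f1 f2; ring.
by field.
Qed.

(* The resultant of X^2 - (2 - q) X + 1 and the characteristic polynomial of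
   the oscillator; it vanishes only if they share a root on the unit circle. *)
Definition resonance q d w : C :=
  let tau := 2 - w - (2 - q) * (1 + d + w / 2) in
  tau ^+ 2 + (2 - q) * tau * (2 * d) + (2 * d) ^+ 2.

(** For 0 < q < 4 the resultant is a real square plus d^2 q (4 - q), positive by damping. At q = 0
    that last term vanishes, but the value is then 4 w^2. *)
Lemma resonance_neq0 q d w :
  0 < d -> 0 < w -> 0 <= q -> q < 4 -> resonance q d w != 0.
Proof.
move=> d0 w0 q0 q4; have [-> | qn0] := eqVneq q 0.
  have -> : resonance 0 d w = 4 * w ^+ 2 by rewrite /resonance; field.
  by rewrite mulf_neq0 ?pnatr_eq0 // expf_neq0 // gt_eqF.
have qp : 0 < q by rewrite lt_neqAle eq_sym qn0.
have -> : resonance q d w =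
  (2 - w - (2 - q) * (1 + d + w / 2) + (2 - q) * d) ^+ 2 + d ^+ 2 * (q * (4 - q)).
  by rewrite /resonance; ring.
apply: lt0r_neq0; rewrite ltr_wpDl //; last by rewrite !mulr_gt0 ?exprn_gt0 ?subr_gt0.
have dR : d \is Num.real := gtr0_real d0.
have wR : w \is Num.real := gtr0_real w0.
have qR : q \is Num.real := gtr0_real qp.
have nR n : n%:R \is @Num.real C by apply: realn.
rewrite real_exprn_even_ge0 //.
have Dr : 1 + d + w / 2 \is Num.real by rewrite !realD ?realM ?realV ?real1 ?nR.
by rewrite realD ?realM ?realB ?realM ?realB ?nR.
Qed.

(* A solution of the discrete wave equation driven by y' - y, found by
   Cayley-Hamilton as a combination of y and y'. *)
Lemma driven_wave_solution q d w :
  1 + d + w / 2 != 0 -> resonance q d w != 0 ->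
  exists k0 k1, forall y y1 y2 y3,
    (1 + d + w / 2) * y2 = (2 - w) * y1 - (1 - d + w / 2) * y ->
    (1 + d + w / 2) * y3 = (2 - w) * y2 - (1 - d + w / 2) * y1 ->
    (k1 * y3 + k0 * y2) - (2 - q) * (k1 * y2 + k0 * y1) + (k1 * y1 + k0 * y)
    = y1 - y.
Proof.
set D := 1 + d + w / 2 => D0 K0.
pose tau := 2 - w - (2 - q) * D.
(* Modulo the oscillator polynomial, X^2 - (2 - q) X + 1 equals (tau X + 2d) / D. Requiring its
   product with k1 X + k0 to reduce to X - 1 is a 2x2 linear system of determinant
   [resonance q d w]; Cramer's rule gives k0 here and k1 next. *)
exists ((tau * (D - 2 * d) - tau * (2 - w) - 2 * d * D) / resonance q d w).
exists (D * (2 * d + tau) / resonance q d w) => y y1 y2 y3 e2 e3.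
have {}e2 : y2 = ((2 - w) * y1 - (1 - d + w / 2) * y) / D.
  by rewrite -e2 [D * _]mulrC mulfK.
have {}e3 : y3 = ((2 - w) * y2 - (1 - d + w / 2) * y1) / D.
  by rewrite -e3 [D * _]mulrC mulfK.
apply: (mulIf K0); rewrite e3 e2 /tau.
rewrite /resonance -/D in K0 *.
have -> : 1 - d + w / 2 = D - 2 * d by rewrite /D; field.
move: D D0 K0 {tau e2 e3} => D D0 K0.
by field; rewrite D0 K0.
Qed.


(** * Energy balance of one full step, with and without coupling *)

Definition lorentz_step s d w a b x y z b' x' y' z' :=
  [/\ b' = b - s * x, x' - x = s^* * b' - (y' - y),
      y' - y = 1 / 2 * (z' + z) &
      z' - z = - (d * (z' + z)) + w * a * (x' + x) - w * (y' + y)].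

(** The field loses the work of y' - y = (z' + z)/2 against [x' + x], the oscillator gains that of w
    a (x' + x) against [z' + z]; the factor 2 w a makes them cancel. *)
Lemma coupled_energy_step s d w a b x y z b' x' y' z' :
  0 <= d -> w^* = w -> a^* = a ->
  lorentz_step s d w a b x y z b' x' y' z' ->
  2 * (w * a) * yee_energy s b' x' + oscillator_energy w y' z' <=
  2 * (w * a) * yee_energy s b x + oscillator_energy w y z.
Proof.
move=> d0 wR aR [eb ex ey ez].
have dR : d^* = d by apply: conj_Creal; apply: ger0_real.
rewrite (yee_energy_step s b x (y' - y) b' x') //.
rewrite (oscillator_energy_step d w y z (w * a * (x' + x)) y' z') //.
rewrite -subr_ge0 ey.
set X := x' + x; set Z := z' + z.
suff -> : forall u v : C, 2 * (w * a) * u + v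
    - (2 * (w * a) * (u - (1 / 2 * Z * X^* + (1 / 2 * Z)^* * X) / 2)
     + (v - d * (Z * Z^*) + (w * a * X * Z^* + (w * a * X)^* * Z) / 2))
    = d * (Z * Z^*) by rewrite mulr_ge0 ?mul_conjC_ge0.
move=> u v; rewrite !(rmorphM, fmorphV, rmorph1) /= ?conjC_nat wR aR.
by field.
Qed.

(* Without coupling, subtracting the particular solution driven by the
   polarization leaves a solution of the free Yee scheme. *)
Lemma free_wave_energy_step s b x y b' x' y' u u1 u2 :
  b' = b - s * x -> x' - x = s^* * b' - (y' - y) ->
  u2 - (2 - s * s^*) * u1 + u = y' - y ->
  yee_energy s (b' - s * u1) (x' + (u2 - u1))
  = yee_energy s (b - s * u) (x + (u1 - u)).
Proof.
move=> eb ex eu.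
(* The subtracted solution has magnetic part s u and electric part -(u1 - u), with [u] as a
   potential: the first equation holds identically, the second is the hypothesis on [u]. Hence the
   difference has source 0. *)
rewrite (@yee_energy_step s (b - s * u) (x + (u1 - u)) 0) ?rmorph0.
- by field.
- by rewrite eb; ring.
have -> : s^* * (b' - s * u1) = x' - x + (y' - y) - s * s^* * u1.
  by rewrite ex; ring.
by rewrite -eu; ring.
Qed.

End Energies.

(** * From energies to bounded powers of the amplification matrix *)

Section PowerBounds.
Local Open Scope complex_scope.
Context {R : realType}.

(** The columns of A^n are orbits of basis vectors; each stays in a sublevel set of [H], which is
    bounded by coercivity. *)
Lemma powers_bounded_of_lyapunov (A : 'M[R[i]]_4) (H : 'cV[R[i]]_4 -> R[i]) :
  (forall v, H (A *m v) <= H v) ->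
  (forall B, exists M, forall v, H v <= B -> forall i, `|v i 0| <= M) ->
  bounded_powers A.
Proof.
move=> decr coer.
have [M hM] := fin_all_exists (fun j => coer (H (delta_mx j 0))).
have hn n v : H (A ^+ n *m v) <= H v.
  elim: n => [|n IH]; first by rewrite expr0 mul1mx.
  by rewrite exprS -mulmxE -mulmxA; exact: le_trans (decr _) IH.
(* The bounds [M j] live in [R[i]]; a sum of moduli is real, so taking its real part loses
   nothing. *)
exists (complex.Re (\sum_j `|M j|)) => n i j.
rewrite RRe_real; last by apply: ger0_real; apply: sumr_ge0.
have h : `|(A ^+ n) i j| <= M j.
  have := hM j _ (hn n (delta_mx j 0)) i.
  by rewrite -colE mxE.
have Mj0 : 0 <= M j by apply: le_trans h.
apply: (le_trans h); rewrite (bigD1 j) //= ger0_norm // lerDl.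
by apply: sumr_ge0.
Qed.

Let cB (v : 'cV[R[i]]_4) : R[i] := v (@Ordinal 4 0 isT) 0.
Let cE (v : 'cV[R[i]]_4) : R[i] := v (@Ordinal 4 1 isT) 0.
Let cP (v : 'cV[R[i]]_4) : R[i] := v (@Ordinal 4 2 isT) 0.
Let cJ (v : 'cV[R[i]]_4) : R[i] := v (@Ordinal 4 3 isT) 0.

Lemma component_norm_le (v : 'cV[R[i]]_4) (M : R[i]) :
  `|cB v| <= M -> `|cE v| <= M -> `|cP v| <= M -> `|cJ v| <= M ->
  forall i, `|v i 0| <= M.
Proof.
move=> hB hE hP hJ [[|[|[|[|//]]]] h] /=.
all: by rewrite (bool_irrelevance h isT).
Qed.

(** The equivalence [normalized_iff], read from the explicit rows back to the implicit equations
    used by the energies. *)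
Lemma G_step (p : params R) xi (v : 'cV[R[i]]_4) : Delta p != 0 ->
  let v' := G p xi *m v in
  lorentz_step (sigma p xi) (delta p)%:C (omega p)%:C (alpha p)%:C
    (cB v) (cE v) (cP v) (cJ v) (cB v') (cE v') (cP v') (cJ v').
Proof.
move=> D0 v'.
have n2 : 2 != 0 :> R[i] by rewrite pnatr_eq0.
have DC0 : (Delta p)%:C != 0 by rewrite fmorph_eq0.
have := @normalized_iff _ (sigma p xi) (sigma p xi)^*%R (delta p)%:C (omega p)%:C
    (alpha p)%:C (cB v) (cE v) (cP v) (cJ v) (cB v') (cE v') (cP v') (cJ v').
have -> : 1 + (delta p)%:C + 1 / 2 * (omega p)%:C * ((alpha p)%:C + 1)
            = (Delta p)%:C.
  by rewrite /Delta /alpha !(rmorphD, rmorphB, rmorphM, fmorphV, rmorph1, rmorph_nat); ring.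
have -> : 1 / 2 * (omega p)%:C * (alpha p)%:C = (1 / 2 * omega p * alpha p)%:C.
  by rewrite !(rmorphM, fmorphV, rmorph1, rmorph_nat).
rewrite /= -normCK -/(q p xi) -(rmorphM _ (omega p)) => /(_ n2 DC0) [_].
rewrite /lorentz_step -(rmorphM _ (omega p)); apply.
by have /mx4_mulE := erefl v'.
Qed.

Lemma stable_coupled (p : params R) xi :
  0 <= delta p -> 0 < omega p -> 0 < alpha p -> Delta p != 0 ->
  sigma p xi * (sigma p xi)^*%R < 4 -> bounded_powers (G p xi).
Proof.
move=> d0 w0 a0 D0 q4.
have dC : 0 <= (delta p)%:C by rewrite lecR.
have wC : 0 < (omega p)%:C by rewrite ltcR.
have aC : 0 < (alpha p)%:C by rewrite ltcR.
set s := sigma p xi in q4.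
pose k := 2 * ((omega p)%:C * (alpha p)%:C).
have k0 : 0 < k by rewrite !mulr_gt0.
apply: (@powers_bounded_of_lyapunov _ (fun v =>
  k * yee_energy s (cB v) (cE v) + oscillator_energy (omega p)%:C (cP v) (cJ v))).
  move=> v; apply: coupled_energy_step (G_step p xi v D0) => //.
    by apply: conj_Creal; apply: gtr0_real.
  by apply: conj_Creal; apply: gtr0_real.
move=> B.
have [M1 h1] := yee_energy_coercive s (B / k) q4.
have [M2 h2] := oscillator_energy_coercive _ B wC.
exists (`|M1| + `|M2|) => v h.
have Y0 := yee_energy_ge0 s (cB v) (cE v) q4.
have O0 := oscillator_energy_ge0 _ (cP v) (cJ v) wC.
have [hb hx] : `|cB v| <= M1 /\ `|cE v| <= M1.
  apply: h1; rewrite ler_pdivlMr // mulrC; apply: le_trans h.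
  by rewrite lerDl.
have [hy hz] : `|cP v| <= M2 /\ `|cJ v| <= M2.
  by apply: h2; apply: le_trans h; rewrite lerDr mulr_ge0 // ltW.
have M10 : 0 <= M1 by apply: le_trans hb.
have M20 : 0 <= M2 by apply: le_trans hy.
rewrite (ger0_norm M10) (ger0_norm M20).
by apply: component_norm_le; [apply: (le_trans hb)|apply: (le_trans hx)
  |apply: (le_trans hy)|apply: (le_trans hz)]; rewrite ?lerDl ?lerDr.
Qed.

Lemma stable_uncoupled (p : params R) xi :
  0 < delta p -> 0 < omega p -> alpha p = 0 -> Delta p != 0 ->
  sigma p xi * (sigma p xi)^*%R < 4 -> bounded_powers (G p xi).
Proof.
move=> d0 w0 a0 D0 q4.
have dC : 0 < (delta p)%:C by rewrite ltcR.
have wC : 0 < (omega p)%:C by rewrite ltcR.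
have wR : (omega p)%:C^*%R = (omega p)%:C by apply: conj_Creal; apply: gtr0_real.
have DC0 : 1 + (delta p)%:C + (omega p)%:C / 2 != 0.
  by rewrite gt_eqF // !addr_gt0 ?divr_gt0.
set A := G p xi.
have step v := G_step p xi v D0; rewrite a0 -/A /= in step.
set s := sigma p xi in q4 step.
have q0 : 0 <= s * s^*%R by apply: mul_conjC_ge0.
have [k0 [k1 hk]] := driven_wave_solution _ _ _ DC0
  (resonance_neq0 _ _ _ dC wC q0 q4).
(* The potential of the driven solution, as a function of the current state, so that one time step
   replaces [v] by [A *m v]. *)
pose u v := k1 * cP (A *m v) + k0 * cP v.
have rec v : (1 + (delta p)%:C + (omega p)%:C / 2) * cP (A *m (A *m v)) =
    (2 - (omega p)%:C) * cP (A *m v) - (1 - (delta p)%:C + (omega p)%:C / 2) * cP v.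
  have [_ _ ey ez] := step v; have [_ _ ey' ez'] := step (A *m v).
  by apply: oscillator_recurrence ey _ ey' _; rewrite ?ez ?ez' mulr0 mul0r addr0.
have V_decr v : oscillator_energy (omega p)%:C (cP (A *m v)) (cJ (A *m v))
    <= oscillator_energy (omega p)%:C (cP v) (cJ v).
  (* At zero coupling the field energy has weight 0, so only the oscillator energy remains. *)
  have := coupled_energy_step _ _ _ _ _ _ _ _ _ _ _ _ (ltW dC) wR (rmorph0 _) (step v).
  by rewrite !mulr0 !mul0r !add0r.
have Y0 v : 0 <= yee_energy s (cB v - s * u v) (cE v + (u (A *m v) - u v)).
  exact: yee_energy_ge0.
apply: (@powers_bounded_of_lyapunov _ (fun v =>
  yee_energy s (cB v - s * u v) (cE v + (u (A *m v) - u v))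
  + oscillator_energy (omega p)%:C (cP v) (cJ v))).
  move=> v; apply: lerD; last exact: V_decr.
  have [eb ex _ _] := step v.
  have eu : u (A *m (A *m v)) - (2 - s * s^*%R) * u (A *m v) + u v
            = cP (A *m v) - cP v := hk _ _ _ _ (rec v) (rec (A *m v)).
  by rewrite (free_wave_energy_step _ _ _ _ _ _ _ _ _ _ eb ex eu).
move=> B.
have [M1 h1] := yee_energy_coercive s B q4.
have [M2 h2] := oscillator_energy_coercive _ B wC.
(* [N] bounds [u] at both [v] and [A *m v], since the oscillator energy does not increase; this
   allows the shift to be undone in [cB] and [cE]. *)
pose N := (`|k1| + `|k0|) * `|M2|.
exists (`|M1| + `|M2| + (1 + `|s|) * (N + N)) => v h.
have hV : oscillator_energy (omega p)%:C (cP v) (cJ v) <= B.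
  by apply: le_trans h; rewrite lerDr.
have [hb hx] : `|cB v - s * u v| <= M1 /\ `|cE v + (u (A *m v) - u v)| <= M1.
  by apply: h1; apply: le_trans h; rewrite lerDl; apply: oscillator_energy_ge0.
have [hy hz] := h2 _ _ hV.
have M10 : 0 <= M1 by apply: le_trans hb.
have M20 : 0 <= M2 by apply: le_trans hy.
have hu v1 : oscillator_energy (omega p)%:C (cP v1) (cJ v1) <= B -> `|u v1| <= N.
  move=> hV1; rewrite /u /N (ger0_norm M20) mulrDl.
  have [hy0 _] := h2 _ _ hV1; have [hy1 _] := h2 _ _ (le_trans (V_decr v1) hV1).
  apply: (le_trans (ler_normD _ _)); rewrite !normrM.
  by apply: lerD; apply: ler_wpM2l.
have hu0 := hu v hV; have hu1 := hu _ (le_trans (V_decr v) hV).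
have N0 : 0 <= N by apply: le_trans hu0.
rewrite (ger0_norm M10) (ger0_norm M20) mulrDl mul1r.
have NN0 : 0 <= N + N by apply: addr_ge0.
have sN0 : 0 <= `|s| * (N + N) by rewrite mulr_ge0.
have hsu : `|s * u v| <= `|s| * (N + N).
  by rewrite normrM ler_wpM2l // (le_trans hu0) // lerDl.
have hdu : `|u (A *m v) - u v| <= N + N.
  by apply: (le_trans (ler_normB _ _)); apply: lerD.
move: (N + N) (`|s| * _) NN0 sN0 hsu hdu => K L K0 L0 hsu hdu.
apply: component_norm_le.
- rewrite -[cB v](subrK (s * u v)).
  apply: (le_trans (ler_normD _ _)); apply: (le_trans (lerD hb hsu)).
  by rewrite addrA lerD // -addrA lerDl addr_ge0.
- rewrite -[cE v](addrK (u (A *m v) - u v)).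
  apply: (le_trans (ler_normB _ _)); apply: (le_trans (lerD hx hdu)).
  by rewrite addrA -[leLHS]addr0 lerD // lerD // lerDl.
- by apply: (le_trans hy); rewrite [M1 + _]addrC -addrA lerDl !addr_ge0.
by apply: (le_trans hz); rewrite [M1 + _]addrC -addrA lerDl !addr_ge0.
Qed.

End PowerBounds.

Theorem mainTheorem4 (R : realType) (p : params R)
    (eps0_gt0 : 0 < eps0 p) (mu0_gt0 : 0 < mu0 p)
    (epsinf_gt0 : 0 < epsinf p) (omega1_gt0 : 0 < omega1 p)
    (dt_gt0 : 0 < dt p) (dx_gt0 : 0 < dx p)
    (epsinf_le_epss : epsinf p <= epss p)
    (nu_gt0 : 0 < nu p)
    (CFL : dt p < dx p / cinf p) :
  stable p.
Proof.
move=> xi.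
have c0 : 0 < cinf p by rewrite divr_gt0 // sqrtr_gt0 !mulr_gt0.
have d0 : 0 < delta p by rewrite divr_gt0 // mulr_gt0.
have w0 : 0 < omega p by rewrite divr_gt0 // mulr_gt0 // exprn_gt0.
have a0 : 0 <= alpha p by rewrite subr_ge0 ler_pdivlMr // mul1r.
have D0 : Delta p != 0.
  have es0 : 0 < epss' p by rewrite divr_gt0 // (lt_le_trans epsinf_gt0).
  by rewrite /Delta mul1r gt_eqF // !addr_gt0 // mulr_gt0 // mulr_gt0 // invr_gt0.
(* The time step condition says lambda < 1, and q = 4 lambda^2 sin^2(xi/2) <= 4 lambda^2. *)
have q4 : sigma p xi * (sigma p xi)^* < 4.
  rewrite -normCK -/(q p xi) qE.
  have -> : (4 : R[i]) = (4 : R)%:C%C by rewrite rmorph_nat.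
  rewrite ltcR.
  have l0 : 0 <= lambda p by rewrite ltW // divr_gt0 // mulr_gt0.
  have l1 : lambda p < 1.
    by rewrite /lambda ltr_pdivrMr // mul1r mulrC -ltr_pdivlMr.
  have s1 : sin (xi / 2) ^+ 2 <= 1.
    by rewrite -[leRHS](cos2Dsin2 (xi / 2)) lerDr sqr_ge0.
  apply: (@le_lt_trans _ _ (4 * lambda p ^+ 2)).
    by rewrite ler_piMr // mulr_ge0 // sqr_ge0.
  by rewrite gtr_pMr // expr_lt1.
have [ap|an|a00] := ltgtP 0 (alpha p).
- by apply: stable_coupled => //; apply: ltW.
- by rewrite leNgt an in a0.
- exact: stable_uncoupled.
Qed.
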